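(* Fix an integer $d\ge 2$. Let $(H_n)$ be a sequence of hypergraphs, where $H_n=\langle V_n,E_n\rangle$ is a $d$-uniform, $k$-regular hypergraph on $n$ vertices with $k=k(n)\to\infty$ as $n\to\infty$, and such that every codegree in $H_n$ is $o(k)$. Then \[M(H_n)\le \left((1+o(1))\frac{k}{e^{d-1}}\right)^{n/d}.\]
   Context: A hypergraph is $d$-uniform if every edge has exactly $d$ vertices, and $k$-regular if every vertex lies in exactly $k$ edges. The codegree of two distinct vertices is the number of edges containing both. A perfect matching is a set of pairwise disjoint edges covering all vertices; $M(H)$ denotes the number of perfect matchings of $H$. The $o(\cdot)$ terms are with respect to $n\to\infty$. *)

(* Defs.v *)
From mathcomp Require Import all_boot.

Set Implicit Arguments.
Unset Strict Implicit.
Unset Printing Implicit Defensive.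

Local Open Scope nat_scope.

(* The edges form a set of vertex sets, so there are no multiple edges. *)
Record hypergraph := Hypergraph {
  vertex :> finType;
  edges : {set {set vertex}}
}.

Definition uniform (d : nat) (H : hypergraph) : Prop :=
  forall e : {set H}, e \in edges H -> #|e| = d.

Definition degree (H : hypergraph) (v : H) : nat :=
  #|[set e in edges H | v \in e]|.

Definition regular (k : nat) (H : hypergraph) : Prop :=
  forall v : H, degree v = k.

(* Meant for distinct u and v. *)
Definition codegree (H : hypergraph) (u v : H) : nat :=
  #|[set e in edges H | (u \in e) && (v \in e)]|.

(* Equal to 0 if H has fewer than two vertices. *)
Definition max_codegree (H : hypergraph) : nat :=
  \max_(p : H * H | p.1 != p.2) codegree p.1 p.2.

Definition perfect_matching (H : hypergraph) (M : {set {set H}}) : bool :=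
  [&& M \subset edges H, trivIset M & cover M == [set: H]].

Definition num_perfect_matchings (H : hypergraph) : nat :=
  #|[set M : {set {set H}} | perfect_matching M]|.

(* Main.v *)
(** Fix a labelling of the vertices and reveal the edge of a random perfect
    matching X at each vertex in order of increasing label.  The entropy of X,
    ln M(H), is at most the expected sum over v of ln N_v, where N_v counts the
    edges still possible at v.  It is enough to count v when its label is
    smallest in its block of X, since otherwise N_v = 1.  An edge e is possible
    at v only if no vertex in a block of X meeting e has a smaller label than v.

    Average over independent uniform labels in {0, .., m - 1}, and put
    q = (m - j) / m when v has label j.  Given j, the vertex v is smallest in
    its block with probability q^(d-1), and an edge at v whose d vertices lie in
    distinct blocks stays possible with probability q^(d^2-1).  By the codegree
    condition the other edges number o(nk) in total.  The tangent inequality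
    ln N <= ln y + N / y - 1, with y = k (q^(d-1) + theta)^d and theta -> 0,
    replaces all uses of Jensen's inequality and bounds ln M(H) by n times the
    mean over j of q^(d-1) ln y.  As m -> oo this mean is at most
    (ln k - (d - 1)) / d + d theta, because the mean of q^(d-1) tends to 1 / d
    and that of q^(d-1) ln q to - 1 / d^2. *)

Require Import Defs.
From HB Require Import structures.
From mathcomp Require Import all_boot all_order all_algebra.
From mathcomp Require Import all_classical all_reals all_analysis.
From mathcomp Require Import ring lra.
Import Order.TTheory GRing.Theory Num.Theory.
Import numFieldNormedType.Exports.

Set Implicit Arguments.
Unset Strict Implicit.
Unset Printing Implicit Defensive.

Local Open Scope ring_scope.

(** * Power sums *)

Lemma leq_exp2r_S (m n e : nat) : (m <= n -> m ^ e <= n ^ e)%N.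
Proof. by case: e => // e mn; rewrite leq_exp2r. Qed.

(** The difference of the two powers factors into [r.+1] products, each between [m ^ r] and
    [m.+1 ^ r]. Telescoping these bounds compares power sums with the integral of [x ^ r]. *)
Lemma expnS_sub_bounds (r m : nat) :
  (m ^ r.+1 + r.+1 * m ^ r <= m.+1 ^ r.+1 <= m ^ r.+1 + r.+1 * m.+1 ^ r)%N.
Proof.
have -> : (m.+1 ^ r.+1 = m ^ r.+1 + \sum_(i < r.+1) m.+1 ^ (r - i) * m ^ i)%N.
  have := subn_exp m.+1 m r.+1; rewrite subSnn mul1n /= => <-.
  by rewrite subnKC // leq_exp2r.
have sumC c : (r.+1 * c = \sum_(i < r.+1) c)%N by rewrite sum_nat_const card_ord.
rewrite !leq_add2l !sumC; apply/andP; split; apply: leq_sum => i _.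
  have ir : (i <= r)%N by rewrite -ltnS.
  have <- : (m ^ (r - i) * m ^ i = m ^ r)%N by rewrite -expnD subnK.
  by rewrite leq_mul2r leq_exp2r_S ?orbT.
have ir : (i <= r)%N by rewrite -ltnS.
have <- : (m.+1 ^ (r - i) * m.+1 ^ i = m.+1 ^ r)%N by rewrite -expnD subnK.
by rewrite leq_mul2l leq_exp2r_S ?orbT.
Qed.

Lemma power_sum_ge (r m : nat) : (m ^ r.+1 <= r.+1 * \sum_(i < m) i.+1 ^ r)%N.
Proof.
elim: m => [|m IHm]; first by rewrite exp0n.
rewrite big_ord_recr /= mulnDr.
have /andP[_ /leq_trans] := expnS_sub_bounds r m; apply.
by rewrite leq_add2r.
Qed.

Lemma power_sum_le (r m : nat) :
  (r.+1 * \sum_(i < m) i.+1 ^ r <= m ^ r.+1 + r.+1 * m ^ r)%N.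
Proof.
case: m => [|m]; first by rewrite big_ord0 muln0.
rewrite big_ord_recr /= mulnDr leq_add2r.
elim: m => [|m IHm]; first by rewrite big_ord0 muln0.
rewrite big_ord_recr /= mulnDr.
have /andP[+ _] := expnS_sub_bounds r m.+1; apply: leq_trans.
by rewrite leq_add2r.
Qed.

Section RealSums.
Variable R : realType.

Lemma ln_le_tangent (x y : R) : 0 < x -> 0 < y -> ln x <= ln y + x / y - 1.
Proof.
move=> x0 y0; rewrite -addrA -lerBlDl -ln_div ?posrE //.
have := @le_ln1Dx R (x / y - 1); rewrite addrCA subrr addr0; apply.
by rewrite ltrBrDl subrr divr_gt0.
Qed.

Lemma exprD_ge (d : nat) (x y : R) : (0 < d)%N -> 0 <= x -> 0 <= y ->
  x ^+ d + y ^+ d <= (x + y) ^+ d.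
Proof.
move=> d0 x0 y0; elim: d d0 => // -[_ _|d /(_ isT) IHd _].
  by rewrite !expr1.
rewrite exprS [y ^+ _]exprS [(x + y) ^+ _]exprS mulrDl lerD //.
- rewrite ler_wpM2l //; apply: le_trans IHd.
  by rewrite lerDl exprn_ge0.
- rewrite ler_wpM2l //; apply: le_trans IHd.
  by rewrite lerDr exprn_ge0.
Qed.

Lemma invS_le_ln (m : nat) : (0 < m)%N -> (m.+1%:R : R)^-1 <= ln m.+1%:R - ln m%:R.
Proof.
move=> m0; have m0R : 0 < m%:R :> R by rewrite ltr0n.
have := ln_le_tangent m0R (ltr0Sn R m).
have -> : m%:R / m.+1%:R = 1 - m.+1%:R^-1 :> R.
  by rewrite -natr1; field; rewrite natr1 pnatr_eq0.
by move: (ln m%:R) (ln m.+1%:R) (m.+1%:R^-1) => a b c; lra.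
Qed.

(** Abel summation: passing from [m] to [m.+1] adds [ln m.+1 - ln m >= 1 / m.+1] times the power sum
    up to [m], which [power_sum_ge] bounds below. *)
Lemma sum_pow_ln_ratio_ge (r m : nat) :
  (\sum_(i < m) i.+1 ^ r.+1)%:R / r.+2%:R - (\sum_(i < m) i.+1 ^ r)%:R
  <= \sum_(i < m) i.+1%:R ^+ r.+1 * (ln m%:R - ln i.+1%:R) :> R.
Proof.
elim: m => [|m IHm]; first by rewrite !big_ord0 mul0r subr0.
rewrite !big_ord_recr /= subrr mulr0 addr0.
rewrite (eq_bigr (fun i : 'I_m => i.+1%:R ^+ r.+1 * (ln m%:R - ln i.+1%:R)
    + (i.+1 ^ r.+1)%:R * (ln m.+1%:R - ln m%:R))); last first.
  by move=> i _; rewrite natrX -mulrDr; congr (_ * _); ring.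
rewrite big_split /= -mulr_suml -natr_sum !natrD.
set P := (\sum_(i < m) _ ^ _.+1)%N in IHm *.
suff step : ((m.+1 ^ r.+1)%:R / r.+2%:R - (m.+1 ^ r)%:R
    <= P%:R * (ln m.+1%:R - ln m%:R) :> R).
  by rewrite mulrDl opprD addrACA lerD.
(* Here [ln 0] is a default value, annihilated by the empty sum [P]. *)
case: (posnP m) => [m0|m0].
  rewrite /P m0 big_ord0 mul0r !exp1n mul1r subr_le0 invf_le1 ?ltr0n //.
  by rewrite ler1n.
apply: (@le_trans _ _ (P%:R / m.+1%:R)); last first.
  by rewrite ler_wpM2l ?invS_le_ln.
have m1 : m.+1%:R != 0 :> R by rewrite pnatr_eq0.
rewrite ler_pdivlMr ?ltr0n // mulrBl mulrAC -!natrM -expnSr.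
rewrite -lerBrDr opprK ler_pdivrMr ?ltr0n //.
have := power_sum_ge r.+1 m.+1; rewrite big_ord_recr /= -/P.
by rewrite -natrD -natrM ler_nat -expnSr mulnC => ->.
Qed.

Lemma mean_pow_le (r m : nat) : (0 < m)%N ->
  m%:R^-1 * \sum_(i < m) (i.+1%:R / m%:R) ^+ r <= r.+1%:R^-1 + m%:R^-1 :> R.
Proof.
move=> m0; have mR : 0 < m%:R :> R by rewrite ltr0n.
under eq_bigr do rewrite expr_div_n -natrX.
rewrite -mulr_suml -natr_sum.
have := power_sum_le r m; rewrite -(ler_nat R) natrD !natrM !natrX.
set S := (\sum_(_ < m) _)%N => h.
rewrite mulrCA -invfM -exprS ler_pdivrMr ?exprn_gt0 //.
rewrite -(ler_pM2l (ltr0Sn R r)); apply: (le_trans h).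
rewrite le_eqVlt; apply/orP; left; apply/eqP; rewrite exprS.
by field; rewrite ?nat1r ?pnatr_eq0 -?lt0n m0.
Qed.

(** A Riemann sum for the integral of [x ^ r.+1 * ln x] over the unit interval, which is
    [- 1 / r.+2 ^ 2], with error [1 / m]. *)
Lemma mean_pow_ln_le (r m : nat) : (0 < m)%N ->
  m%:R^-1 * \sum_(i < m) (i.+1%:R / m%:R) ^+ r.+1 * ln (i.+1%:R / m%:R)
  <= m%:R^-1 - r.+2%:R^-2 :> R.
Proof.
move=> m0; have mR : 0 < m%:R :> R by rewrite ltr0n.
rewrite (eq_bigr (fun i : 'I_m => - (m%:R ^- r.+1 *
    (i.+1%:R ^+ r.+1 * (ln m%:R - ln i.+1%:R))))); last first.
  move=> i _; rewrite ln_div ?posrE ?ltr0n // expr_div_n; ring.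
rewrite sumrN -mulr_sumr mulrN lerNl opprB mulrA -invfM -exprS mulrC.
rewrite ler_pdivlMr ?exprn_gt0 //; apply: le_trans (sum_pow_ln_ratio_ge r m).
have h1 : m%:R ^+ r.+2 / r.+2%:R <= (\sum_(i < m) i.+1 ^ r.+1)%:R :> R.
  by rewrite ler_pdivrMr ?ltr0n // -natrX -natrM ler_nat mulnC power_sum_ge.
have h2 : (\sum_(i < m) i.+1 ^ r)%:R <= m%:R ^+ r.+1 :> R.
  rewrite -natrX ler_nat expnS -[m in (m * _)%N]card_ord -sum_nat_const.
  by apply: leq_sum => i _; rewrite leq_exp2r_S.
have m_neq0 : m%:R != 0 :> R by rewrite pnatr_eq0 -lt0n.
have -> : (r.+2%:R^-2 - m%:R^-1) * m%:R ^+ r.+2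
    = m%:R ^+ r.+2 / r.+2%:R / r.+2%:R - m%:R ^+ r.+1 :> R.
  by rewrite [m%:R ^+ r.+2]exprS; field; rewrite m_neq0 -natrD pnatr_eq0.
by rewrite lerB // ler_wpM2r ?invr_ge0.
Qed.
End RealSums.

(** * Sequential choice and random labels *)
Section SequentialChoice.
Variables (R : realType) (T V E : finType) (c : V -> T -> E).

(* The probability of ending in [x] when the coordinates in [s] are revealed
   one by one, each uniformly among the values that [S] still allows. *)
Fixpoint choice_weight (S : {set T}) (s : seq V) (x : T) : R :=
  if s is v :: s' then
    #|c v @: S|%:R^-1 * choice_weight (S :&: [set y | c v y == c v x]) s' x
  else 1.

Lemma choice_weight_gt0 (S : {set T}) (s : seq V) (x : T) :
  x \in S -> 0 < choice_weight S s x.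
Proof.
elim: s S => //= v s IHs S xS; rewrite mulr_gt0 ?IHs ?inE ?xS ?eqxx //.
by rewrite invr_gt0 ltr0n card_gt0; apply/set0Pn; exists (c v x); apply: imset_f.
Qed.

(** The weights form a subprobability: by induction each value of the first choice carries at most
    [1 / #|c v @: S|], and at most one element is left once every choice is revealed. *)
Lemma sum_choice_weight_le1 (S : {set T}) (s : seq V) :
  {in S &, forall x y, (forall v, v \in s -> c v x = c v y) -> x = y} ->
  \sum_(x in S) choice_weight S s x <= 1.
Proof.
elim: s S => [|v s IHs] S sepS /=.
  rewrite sumr_const lern1; apply/card_le1_eqP => x y xS yS.
  exact: sepS.
rewrite (partition_big_imset (c v)) /=.
have [S0|S_gt0] := posnP #|c v @: S|.
  by rewrite (cards0_eq S0) big_set0.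
rewrite (@le_trans _ _ (\sum_(e in c v @: S) #|c v @: S|%:R^-1)) //; last first.
  by rewrite sumr_const -[_ *+ _]mulr_natr mulVf // pnatr_eq0 -lt0n.
apply: ler_sum => e _.
rewrite (eq_bigr (fun x => #|c v @: S|%:R^-1 *
   choice_weight (S :&: [set y | c v y == e]) s x)); last first.
  by move=> x /andP[_ /eqP->].
rewrite -mulr_sumr ler_piMr ?invr_ge0 //.
rewrite (eq_bigl (mem (S :&: [set y | c v y == e]))); last first.
  by move=> x; rewrite !inE.
apply: IHs => x y /[!inE] /andP[xS /eqP xe] /andP[yS /eqP ye] eq_s.
apply: sepS => // u /[!inE] /predU1P[->|/eq_s //].
by rewrite xe ye.
Qed.

(** Gibbs' inequality between the uniform distribution and the choice weights [w]: sum
    [ln (#|S| * w) <= #|S| * w - 1] over [S]. It serves as the entropy chain rule. *)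
Lemma card_ln_card_le_choice (S : {set T}) (s : seq V) :
  {in S &, forall x y, (forall v, v \in s -> c v x = c v y) -> x = y} ->
  #|S|%:R * ln #|S|%:R <= \sum_(x in S) - ln (choice_weight S s x).
Proof.
move=> sepS; have [S0|S_gt0] := posnP #|S|.
  by rewrite S0 mul0r (cards0_eq S0) big_set0.
have SR : 0 < #|S|%:R :> R by rewrite ltr0n.
rewrite mulr_natl -sumr_const -subr_le0 -sumrB.
apply: (@le_trans _ _ (\sum_(x in S) (#|S|%:R * choice_weight S s x - 1))).
  apply: ler_sum => x xS; have w0 := choice_weight_gt0 s xS.
  rewrite opprK -lnM ?posrE //.
  have := ln_le_tangent (mulr_gt0 SR w0) ltr01.
  by rewrite ln1 add0r divr1.
rewrite sumrB -mulr_sumr sumr_const subr_le0.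
by rewrite ler_piMr ?sum_choice_weight_le1.
Qed.
End SequentialChoice.

Section LabelCount.
Variables (R : realType) (V : finType) (m : nat).
Hypothesis m_gt0 : (0 < m)%N.

Lemma sum_family_prod (F : V -> pred 'I_m) :
  #|[set l : {ffun V -> 'I_m} | [forall w, F w (l w)]]|%:R / m%:R ^+ #|V|
  = \prod_w (#|F w|%:R / m%:R) :> R.
Proof.
rewrite prodf_div /= prodr_const -natr_prod; congr (_%:R / _).
rewrite cardsE -[LHS](_ : #|family F| = _); last by apply: eq_card => l; rewrite !inE.
by rewrite card_family foldrE big_map big_enum.
Qed.

Lemma card_ord_ge (j : 'I_m) : #|[pred i : 'I_m | (j <= i)%N]| = (m - j)%N.
Proof.
rewrite cardE /enum_mem size_filter -enumT -(count_map val (leq j)) val_enum_ord.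
have -> : iota 0 m = iota 0 j ++ iota j (m - j).
  by rewrite -{2}[nat_of_ord j]add0n -iotaD subnKC // ltnW.
rewrite count_cat.
rewrite (_ : count _ (iota 0 j) = 0%N).
  rewrite add0n -[RHS](size_iota j); apply/eqP; rewrite -all_count.
  by apply/allP => i; rewrite mem_iota => /andP[].
apply/eqP; rewrite -leqn0 leqNgt -has_count -all_predC.
by apply/allP => i; rewrite mem_iota add0n /= -ltnNge.
Qed.

(** By independence, [v] contributes [1 / m], every other vertex of [U] the fraction [(m - j) / m]
    of labels at least [j] (ties allowed), and vertices outside [U] contribute 1. *)
Lemma label_density (v : V) (U : {set V}) (j : 'I_m) : v \in U ->
  #|[set l : {ffun V -> 'I_m} |
      (l v == j) && [forall w in U, (j <= l w)%N]]|%:R / m%:R ^+ #|V|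
  = m%:R^-1 * ((m - j)%:R / m%:R) ^+ #|U|.-1 :> R.
Proof.
move=> vU; have mR : m%:R != 0 :> R by rewrite pnatr_eq0 -lt0n.
pose F w : pred 'I_m :=
  if w == v then pred1 j else if w \in U then [pred i : 'I_m | (j <= i)%N] else predT.
rewrite (_ : [set l | _] = [set l : {ffun V -> 'I_m} | [forall w, F w (l w)]]).
  rewrite sum_family_prod (bigD1 v) //= /F eqxx card1 mul1r; congr (_ * _).
  rewrite (bigID [pred w | w \in U]) /= [X in _ * X]big1 ?mulr1; last first.
    by move=> w /andP[/negPf-> /negPf->]; rewrite card_ord divff.
  rewrite (eq_bigr (fun=> (m - j)%:R / m%:R)); last first.
    by move=> w /andP[/negPf-> ->]; rewrite card_ord_ge.
  rewrite prodr_const; congr (_ ^+ _).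
  by rewrite (cardsD1 v U) vU /=; apply: eq_card => w; rewrite !inE.
apply/setP => l; rewrite !inE; apply/andP/forallP => [[/eqP lv /forall_inP h] w|h].
  rewrite /F; case: eqP => [->|_]; first by rewrite inE lv.
  by case: ifP => // /h; rewrite inE.
have /eqP lv : l v == j by have := h v; rewrite /F eqxx.
split; first exact/eqP.
apply/forall_inP => w wU; have := h w; rewrite /F wU.
by case: eqP => [->|_ //]; rewrite lv.
Qed.
End LabelCount.

(** * Blocks of a perfect matching *)
Section Matching.
Variables (H : hypergraph) (d : nat).
Hypothesis (d_gt0 : (0 < d)%N) (unifH : uniform d H).
Variable X : {set {set H}}.
Hypothesis pmX : perfect_matching X.

Lemma mem_block v : v \in finset.pblock X v.
Proof. by case/and3P: pmX => _ _ /eqP cX; rewrite finset.mem_pblock cX inE. Qed.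

Lemma block_in_matching v : finset.pblock X v \in X.
Proof. by case/and3P: pmX => _ _ /eqP cX; rewrite finset.pblock_mem // cX inE. Qed.

Lemma block_edge v : finset.pblock X v \in edges H.
Proof. by case/and3P: pmX => /fintype.subsetP sX _ _; apply/sX/block_in_matching. Qed.

Lemma card_block v : #|finset.pblock X v| = d.
Proof. exact/unifH/block_edge. Qed.

Lemma block_eq u v : u \in finset.pblock X v -> finset.pblock X u = finset.pblock X v.
Proof. by case/and3P: pmX => _ tX _; apply: finset.same_pblock. Qed.

(** Edges are nonempty, so each edge of [X] is the block of one of its vertices; hence the blocks
    determine the matching. *)
Lemma matching_eq_blocks : X = [set finset.pblock X v | v : H].
Proof.
case/and3P: (pmX) => /fintype.subsetP sX tX _.
apply/setP => e; apply/idP/imsetP => [eX|[v _ ->]]; last exact: block_in_matching.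
have /finset.set0Pn[v ve] : e != finset.set0 by rewrite -card_gt0 unifH ?sX.
by exists v => //; rewrite (finset.def_pblock tX eX ve).
Qed.

(** Revealing any of these vertices exposes a block of [X] that meets [e]. *)
Definition edge_closure (e : {set H}) : {set H} := \bigcup_(u in e) finset.pblock X u.

(** The exceptional edges, whose closure may be smaller than [d * d]. When [d >= 2] they include the
    edges of [X] itself. *)
Definition splits_block (e : {set H}) : bool :=
  [exists u in e, exists w in e, (u != w) && (finset.pblock X u == finset.pblock X w)].

Lemma card_edge_closure (e : {set H}) :
  e \in edges H -> ~~ splits_block e -> #|edge_closure e| = (d * d)%N.
Proof.
move=> eE nsplit; case/and3P: (pmX) => _ tX _.
have inj : {in e &, injective (finset.pblock X)}.
  move=> u w ue we eq_uw; apply: contraNeq nsplit => neq_uw.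
  by apply/exists_inP; exists u => //; apply/exists_inP;
    exists w; rewrite // neq_uw eq_uw /=.
have sPX : finset.pblock X @: e \subset X.
  by apply/fintype.subsetP => _ /imsetP[u _ ->]; apply: block_in_matching.
have <- : finset.cover (finset.pblock X @: e) = edge_closure e.
  by rewrite /finset.cover big_imset.
have /eqP <- := finset.trivIsetS sPX tX.
rewrite big_imset //= (eq_bigr (fun=> d)) => [|u _]; last exact: card_block.
by rewrite sum_nat_const unifH.
Qed.

Lemma block_sub_edge_closure (e : {set H}) v :
  v \in e -> finset.pblock X v \subset edge_closure e.
Proof. by move=> ve; rewrite /edge_closure (bigD1 v) //= finset.subsetUl. Qed.

Lemma leq_card_edge_closure (e : {set H}) v :
  v \in e -> (d <= #|edge_closure e|)%N.
Proof. by move=> ve; rewrite -(card_block v) subset_leq_card ?block_sub_edge_closure. Qed.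

Lemma mem_edge_closure (e : {set H}) v : v \in e -> v \in edge_closure e.
Proof. by move=> ve; apply/bigcupP; exists v => //; apply: mem_block. Qed.

Lemma leq_codegree (u v : H) : u != v -> (codegree u v <= max_codegree H)%N.
Proof.
move=> uv.
exact: (@leq_bigmax_cond _ (fun p : H * H => p.1 != p.2)
  (fun p : H * H => codegree p.1 p.2) (u, v)).
Qed.

(** An exceptional edge contains some [u] and one of the [d.-1] other vertices of its block; each
    such pair lies in at most [max_codegree H] edges. *)
Lemma card_splits_block :
  (#|[set e in edges H | splits_block e]|
    <= #|H| * (d.-1 * max_codegree H))%N.
Proof.
have sub : [set e in edges H | splits_block e]
    \subset \bigcup_(u : H) \bigcup_(w in finset.pblock X u :\ u)
              [set e in edges H | (u \in e) && (w \in e)].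
  apply/fintype.subsetP => e /[!inE] /andP[eE /exists_inP[u ue
      /exists_inP[w we /andP[uw /eqP eq_uw]]]].
  apply/bigcupP; exists u => //; apply/bigcupP; exists w; last by rewrite inE eE ue we.
  by rewrite !inE eq_sym uw eq_uw mem_block.
apply: leq_trans (subset_leq_card sub) _.
apply: (@leq_trans (\sum_(u : H) \sum_(w in finset.pblock X u :\ u) codegree u w)).
  elim/big_rec2: _ => [|u n B _ leBn]; first by rewrite cards0.
  rewrite (leq_trans (finset.leq_card_setU _ _).1) // leq_add //.
  elim/big_rec2: _ => [|w p C _ leCp]; first by rewrite cards0.
  by rewrite (leq_trans (finset.leq_card_setU _ _).1) // leq_add.
rewrite -sum_nat_const; apply: leq_sum => u _.
have -> : d.-1 = #|finset.pblock X u :\ u|.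
  by rewrite -(card_block u) (cardsD1 u) mem_block.
rewrite -sum_nat_const; apply: leq_sum => w /[!inE] /andP[wu _].
by rewrite leq_codegree // eq_sym.
Qed.

Lemma sum_card_incident_splits :
  (\sum_(v : H) #|[set e in edges H | (v \in e) && splits_block e]|
    <= #|H| * (d * d.-1 * max_codegree H))%N.
Proof.
under eq_bigr do rewrite -sum1_card.
rewrite (exchange_big_dep (fun e => e \in [set e in edges H | splits_block e]))
  /=; last first.
  by move=> v e _; rewrite !inE => /and3P[-> _ ->].
rewrite (eq_bigr (fun=> d)) => [|e /[!inE] /andP[eE sp]].
  by rewrite sum_nat_const mulnC -mulnA mulnCA leq_mul2l card_splits_block orbT.
rewrite -[RHS](unifH eE) -sum1_card; apply: eq_bigl => v.
by rewrite !inE eE sp andbT.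
Qed.
End Matching.

(** * Revealing a matching in a given order *)
(** Condition on the label [j] of [v] and apply [label_density]. *)
Lemma sum_label_first (R : realType) (V : finType) (m : nat) (v : V)
    (U : {set V}) (f : nat -> R) : (0 < m)%N -> v \in U ->
  (\sum_(l : {ffun V -> 'I_m}) [forall w in U, (l v <= l w)%N]%:R * f (l v))
    / m%:R ^+ #|V|
  = \sum_(j < m) m%:R^-1 * ((m - j)%:R / m%:R) ^+ #|U|.-1 * f j.
Proof.
move=> m0 vU; rewrite (partition_big (fun l : {ffun V -> 'I_m} => l v) predT) //=.
rewrite mulr_suml; apply: eq_bigr => j _; rewrite -(label_density R m0 j vU).
rewrite (eq_bigr (fun l : {ffun V -> 'I_m} =>
    [forall w in U, (j <= l w)%N]%:R * f j)); last by move=> l /eqP->.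
rewrite -mulr_suml mulrAC; congr (_ / _ * _).
rewrite -natr_sum -sum1_card; congr _%:R.
rewrite big_mkcond /= [RHS]big_mkcond /=; apply: eq_bigr => l _.
by rewrite inE; case: (l v == j); case: [forall w in U, _].
Qed.

Section Ordering.
Variables (R : realType) (H : hypergraph) (d : nat).
Hypothesis (d_gt0 : (0 < d)%N) (unifH : uniform d H).

Definition matchings : {set {set {set H}}} := [set M | perfect_matching M].

Definition earliest (l : H -> nat) (X : {set {set H}}) (v : H) : bool :=
  [forall w in finset.pblock X v, (l v <= l w)%N].

(** When [v] is earliest in its block, this contains all edges still possible there. Only strictly
    smaller labels count as revealed, so it does not matter how ties are ordered. *)
Definition available (l : H -> nat) (X : {set {set H}}) (v : H) :
    {set {set H}} :=
  [set e in edges H |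
    (v \in e) && [forall w in edge_closure X e, (l v <= l w)%N]].

Definition block_of (v : H) (M : {set {set H}}) : {set H} := finset.pblock M v.

Lemma blocks_separate : {in matchings &, forall X Y,
  (forall v, block_of v X = block_of v Y) -> X = Y}.
Proof.
move=> X Y /[!inE] pX pY eqXY.
rewrite (matching_eq_blocks d_gt0 unifH pX) (matching_eq_blocks d_gt0 unifH pY).
exact: eq_imset.
Qed.

(** Suppose [w] in the closure of the block of [v] in [Y] has a smaller label. Then [X] and [Y]
    share the block of [w], which meets the block of [v] in [Y] and so contains [v]; this
    contradicts that [v] is earliest in [X]. *)
Lemma choices_sub_available (l : H -> nat) (S : {set {set {set H}}}) X v :
  S \subset matchings -> X \in S ->
  (forall u, (l u < l v)%N -> {in S, forall Y, block_of u Y = block_of u X}) ->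
  earliest l X v -> block_of v @: S \subset available l X v.
Proof.
move=> /fintype.subsetP sS XS agree /forall_inP early.
have pX : perfect_matching X by have := sS _ XS; rewrite inE.
apply/fintype.subsetP => _ /imsetP[Y YS ->]; rewrite inE /block_of.
have pY : perfect_matching Y by have := sS _ YS; rewrite inE.
rewrite (block_edge pY) (mem_block pY) /=.
apply/forall_inP => w /bigcupP[u ue wu]; rewrite leqNgt; apply/negP => lw.
have eqw := agree _ lw _ YS; rewrite /block_of in eqw.
have uw : u \in finset.pblock Y w.
  by rewrite eqw (block_eq pX wu) (mem_block pX).
have vw : v \in finset.pblock X w.
  by rewrite -eqw -(block_eq pY uw) (block_eq pY ue) (mem_block pY).
have := early w; rewrite (block_eq pX vw) (mem_block pX) => /(_ isT).
by rewrite leqNgt lw.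
Qed.

(** A vertex of smaller label in the block of [v] has already fixed that block for all of [S]. *)
Lemma choice_unique (l : H -> nat) (S : {set {set {set H}}}) X v :
  S \subset matchings -> X \in S ->
  (forall u, (l u < l v)%N -> {in S, forall Y, block_of u Y = block_of u X}) ->
  ~~ earliest l X v -> block_of v @: S = [set block_of v X]%SET.
Proof.
move=> /fintype.subsetP sS XS agree /forall_inPn[w wX]; rewrite -ltnNge => lw.
have pX : perfect_matching X by have := sS _ XS; rewrite inE.
apply/setP => e; rewrite inE; apply/imsetP/eqP => [[Y YS ->]|->]; last by exists X.
have pY : perfect_matching Y by have := sS _ YS; rewrite inE.
have eqw := agree _ lw _ YS; rewrite /block_of in eqw *.
have vw : v \in finset.pblock X w by rewrite (block_eq pX wX) (mem_block pX).
by rewrite (block_eq pX vw) -eqw; apply: (block_eq pY); rewrite eqw.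
Qed.

(** Induction on the vertices still to reveal, with the invariant that [S] agrees with [X] on all
    others. The tangent at [y (l v)] bounds the cost at an earliest vertex; elsewhere the cost is
    0. *)
Lemma neg_ln_choice_weight_le (l : H -> nat) (y : nat -> R)
    (S : {set {set {set H}}}) (s : seq H) X :
  (forall v, 0 < y (l v)) -> sorted (relpre l leq) s -> S \subset matchings ->
  X \in S ->
  (forall u, u \notin s -> {in S, forall Y, block_of u Y = block_of u X}) ->
  - ln (choice_weight R block_of S s X)
    <= \sum_(v <- s) ((earliest l X v)%:R * (ln (y (l v)) - 1)
                      + #|available l X v|%:R * (y (l v))^-1).
Proof.
move=> y0; elim: s S => [|v s IHs] S /= srt sS XS agree.
  by rewrite big_nil ln1 oppr0.
have tr : transitive (relpre l leq) by move=> a b c /=; apply: leq_trans.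
have /allP minv := order_path_min tr srt.
(* As [s] is sorted, a vertex with a smaller label than [v] has been revealed before. *)
have agree_lt u : (l u < l v)%N -> {in S, forall Y, block_of u Y = block_of u X}.
  move=> lu; apply: agree; rewrite inE negb_or; apply/andP; split.
    by apply: contraTneq lu => ->; rewrite ltnn.
  by apply: contraTN lu => /minv /=; rewrite leqNgt.
have XS' : X \in S :&: [set Y | block_of v Y == block_of v X] by rewrite !inE XS eqxx.
have cS : (0 < #|block_of v @: S|)%N.
  by rewrite card_gt0; apply/set0Pn; exists (block_of v X); apply: imset_f.
rewrite big_cons lnM ?posrE ?invr_gt0 ?ltr0n ?choice_weight_gt0 //.
rewrite lnV ?posrE ?ltr0n // opprD opprK lerD //; last first.
  apply: IHs => //; first exact: path_sorted srt.
    exact: fintype.subset_trans (subsetIl _ _) sS.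
  move=> u us Y /[!inE] /andP[YS /eqP eqv].
  by have [->//|uv] := eqVneq u v; apply: agree; rewrite // inE negb_or uv.
case early: (earliest l X v).
  have le_av := subset_leq_card (choices_sub_available sS XS agree_lt early).
  have cR : 0 < #|block_of v @: S|%:R :> R by rewrite ltr0n.
  apply: le_trans (ln_le_tangent cR (y0 v)) _.
  by rewrite mul1r addrAC lerD2l ler_pM2r ?invr_gt0 // ler_nat.
rewrite (choice_unique sS XS agree_lt) ?early // cards1 ln1 mul0r add0r.
by rewrite mulr_ge0 ?invr_ge0 // ltW.
Qed.

Lemma card_ln_card_matchings_le (l : H -> nat) (y : nat -> R) :
  (forall v, 0 < y (l v)) ->
  #|matchings|%:R * ln #|matchings|%:R
    <= \sum_(X in matchings) \sum_(v : H)
         ((earliest l X v)%:R * (ln (y (l v)) - 1)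
          + #|available l X v|%:R * (y (l v))^-1) :> R.
Proof.
move=> y0; pose s := sort (relpre l leq) (enum H).
have all_s u : u \in s by rewrite mem_sort mem_enum.
apply: le_trans (card_ln_card_le_choice R (c := block_of) (s := s) _) _.
  by move=> X Y XM YM eqXY; apply: blocks_separate => // v; apply: eqXY.
apply: ler_sum => X XM.
apply: le_trans (neg_ln_choice_weight_le y0 _ _ XM _) _ => //.
- by apply: sort_sorted => a b /=; apply: leq_total.
- by move=> u; rewrite all_s.
by rewrite (perm_big (enum H)) ?perm_sort // big_enum.
Qed.
End Ordering.

(** * Averaging over the labels *)
Section Averaging.
Variables (R : realType) (H : hypergraph) (r k : nat) (theta : R).
Hypothesis unifH : uniform r.+1 H.
Hypothesis regH : regular k H.
Hypothesis theta_ge0 : 0 <= theta.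
Hypothesis codeg_le :
  (r.+1 * r * max_codegree H)%:R <= k%:R * theta ^+ r.+1.

(** With [d = r.+1], an ordinary edge has exponent [d * d - 1 = r + r * d]. An exceptional edge has
    exponent at least [r], and [codeg_le] absorbs the number of these into [theta ^+ r.+1]. *)
Lemma sum_pow_edge_closure_le (X : {set {set H}}) (q : R) :
  perfect_matching X -> 0 <= q <= 1 ->
  \sum_(v : H) \sum_(e in edges H | v \in e) q ^+ #|edge_closure X e|.-1
    <= #|H|%:R * k%:R * (q ^+ r * ((q ^+ r) ^+ r.+1 + theta ^+ r.+1)).
Proof.
move=> pmX /andP[q0 q1].
have term v e : (e \in edges H) && (v \in e) ->
    q ^+ #|edge_closure X e|.-1
      <= q ^+ r * (q ^+ r) ^+ r.+1 + (splits_block X e)%:R * q ^+ r.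
  move=> /andP[eE ve]; case: (boolP (splits_block X e)) => sp.
    rewrite mul1r -[leLHS]add0r lerD ?mulr_ge0 ?exprn_ge0 //.
    rewrite ler_wiXn2l // -ltnS (leq_trans (leq_card_edge_closure unifH pmX ve)) //.
    exact: leqSpred.
  rewrite mul0r addr0 (card_edge_closure unifH pmX eE sp) -exprM -exprD.
  by rewrite mulSn.
apply: le_trans (ler_sum _ (fun v _ => ler_sum _ (term v))) _.
under eq_bigr do rewrite big_split /=.
rewrite big_split /= [X in _ <= _ * X]mulrDr mulrDr lerD //.
  rewrite (eq_bigr (fun=> q ^+ r * (q ^+ r) ^+ r.+1 *+ k)); last first.
    move=> v _; rewrite -(regH v) /degree -sumr_const; apply: eq_bigl => e.
    by rewrite inE.
  by rewrite sumr_const -[leRHS]mulrA !mulr_natl.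
under eq_bigr do rewrite -mulr_suml.
rewrite -mulr_suml mulrC.
rewrite [X in _ <= X]mulrCA ler_wpM2l ?exprn_ge0 //.
have := sum_card_incident_splits unifH pmX.
rewrite -(ler_nat R) natr_sum natrM => h.
apply: le_trans (le_trans h _).
  apply: ler_sum => v _; rewrite -sum1_card natr_sum
    big_mkcond [X in _ <= X]big_mkcond /=.
  apply: ler_sum => e _; rewrite inE.
  by case: (e \in edges H); case: (v \in e); case: (splits_block X e).
by rewrite -mulrA ler_wpM2l.
Qed.

(** The value [y j] is chosen to be at least [q ^ - r] times the average over [v] of the expected
    number of available edges given label [j], by [exprD_ge]. *)
Lemma average_choices_le (m : nat) (X : {set {set H}}) (y : nat -> R) :
  (0 < m)%N -> perfect_matching X -> (0 < k)%N ->
  (forall j, (j < m)%N ->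
    y j = k%:R * (((m - j)%:R / m%:R) ^+ r + theta) ^+ r.+1) ->
  (\sum_(l : {ffun H -> 'I_m}) \sum_(v : H)
      ((earliest (fun u => l u) X v)%:R * (ln (y (l v)) - 1)
       + #|available (fun u => l u) X v|%:R * (y (l v))^-1)) / m%:R ^+ #|H|
    <= #|H|%:R * \sum_(j < m) m%:R^-1 * ((m - j)%:R / m%:R) ^+ r * ln (y j).
Proof.
move=> m0 pmX k0 yE; have mR : 0 < m%:R :> R by rewrite ltr0n.
pose q j : R := (m - j)%:R / m%:R.
have q0 (j : 'I_m) : 0 < q j by rewrite divr_gt0 // ltr0n subn_gt0.
have q1 (j : 'I_m) : 0 <= q j <= 1.
  by rewrite ltW //= ler_pdivrMr // mul1r ler_nat leq_subr.
have y0 (j : 'I_m) : 0 < y j.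
  rewrite yE // mulr_gt0 ?ltr0n // exprn_gt0 // ltr_pwDl // exprn_gt0 //.
  exact: q0.
have vertex_mean (v : H) :
    (\sum_(l : {ffun H -> 'I_m})
      ((earliest (fun u => l u) X v)%:R * (ln (y (l v)) - 1)
       + #|available (fun u => l u) X v|%:R * (y (l v))^-1)) / m%:R ^+ #|H| =
    \sum_(j < m) m%:R^-1 * (q j ^+ r * (ln (y j) - 1) +
      (y j)^-1 * \sum_(e in edges H | v \in e) q j ^+ #|edge_closure X e|.-1).
  rewrite big_split /= mulrDl.
  rewrite (sum_label_first (fun j => ln (y j) - 1) m0 (mem_block pmX v)).
  rewrite (card_block unifH pmX) /=.
  have -> : \sum_(l : {ffun H -> 'I_m})
      #|available (fun u => l u) X v|%:R * (y (l v))^-1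
    = \sum_(e in edges H | v \in e) \sum_(l : {ffun H -> 'I_m})
         [forall w in edge_closure X e, (l v <= l w)%N]%:R * (y (l v))^-1.
    rewrite [RHS]exchange_big /=; apply: eq_bigr => l _.
    rewrite -mulr_suml; congr (_ * _).
    rewrite -sum1_card natr_sum big_mkcond [RHS]big_mkcond /=.
    apply: eq_bigr => e _; rewrite inE.
    by case: (e \in edges H); case: (v \in e); case: [forall w in _, _].
  rewrite [X in _ + X]mulr_suml.
  rewrite (eq_bigr (fun e => \sum_(j < m)
      m%:R^-1 * q j ^+ #|edge_closure X e|.-1 * (y j)^-1)); last first.
    move=> e /andP[_ ve].
    exact: (sum_label_first (fun j => (y j)^-1) m0 (mem_edge_closure pmX ve)).
  rewrite exchange_big -big_split /=; apply: eq_bigr => j _.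
  rewrite [RHS]mulrDr; congr (_ + _); first by rewrite -mulrA.
  by rewrite -mulr_suml -mulr_sumr -!mulrA; congr (_ * _); apply: mulrC.
rewrite exchange_big /= mulr_suml (eq_bigr _ (fun v _ => vertex_mean v)).
rewrite exchange_big /= mulr_sumr; apply: ler_sum => j _.
rewrite -mulr_sumr big_split /= sumr_const -mulr_sumr -[_ *+ #|_|](mulr_natl _ #|H|).
rewrite -[m%:R^-1 * _ * _]mulrA [leRHS]mulrCA ler_pM2l ?invr_gt0 //.
rewrite -/(q j).
(* The mean of [N / y] is at most [q ^ r], which pays for the [- 1] of the tangent inequality. *)
have -> : #|H|%:R * (q j ^+ r * ln (y j)) =
   #|H|%:R * (q j ^+ r * (ln (y j) - 1)) + #|H|%:R * q j ^+ r by ring.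
rewrite lerD2l mulrC ler_pdivrMr //.
apply: le_trans (sum_pow_edge_closure_le pmX (q1 j)) _.
rewrite -!mulrA ler_wpM2l // mulrCA ler_wpM2l ?exprn_ge0 ?(ltW (q0 j)) //.
rewrite yE // ler_wpM2l // -/(q j) exprD_ge // exprn_ge0 // ltW //; exact: q0.
Qed.

Lemma ln_card_matchings_le_sum (m : nat) : (0 < m)%N -> (0 < k)%N ->
  (0 < #|matchings H|)%N ->
  ln #|matchings H|%:R <= #|H|%:R * \sum_(i < m) m%:R^-1 *
    ((i.+1%:R / m%:R) ^+ r
      * ln (k%:R * ((i.+1%:R / m%:R) ^+ r + theta) ^+ r.+1)).
Proof.
move=> m0 k0 K0; have mR : 0 < m%:R :> R by rewrite ltr0n.
pose y j : R := k%:R * (((m - j)%:R / m%:R) ^+ r + theta) ^+ r.+1.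
have y0 (j : 'I_m) : 0 < y j.
  rewrite mulr_gt0 ?ltr0n // exprn_gt0 // ltr_pwDl // exprn_gt0 //.
  by rewrite divr_gt0 // ltr0n subn_gt0.
(* Reversing the labels turns [(m - j) / m] into [i.+1 / m]. *)
rewrite (reindex_inj rev_ord_inj) /=.
rewrite (eq_bigr (fun j : 'I_m =>
    m%:R^-1 * ((m - j)%:R / m%:R) ^+ r * ln (y j))); last first.
  by move=> j _; rewrite subnSK // -mulrA.
set B := \sum_(j < m) _.
have KR : 0 < #|matchings H|%:R :> R by rewrite ltr0n.
rewrite -(ler_pM2l KR).
have step (l : {ffun H -> 'I_m}) :=
  card_ln_card_matchings_le (ltn0Sn r) unifH (l := fun v => l v) (y := y)
    (fun v => y0 (l v)).
(* The bound holds for every labelling, so it holds on average; the left side is constant in [l]. *)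
have : (\sum_(l : {ffun H -> 'I_m}) #|matchings H|%:R * ln #|matchings H|%:R)
    / m%:R ^+ #|H| <= #|matchings H|%:R * (#|H|%:R * B) :> R.
  apply: (@le_trans _ _ (\sum_(X in matchings H)
    (\sum_(l : {ffun H -> 'I_m}) \sum_(v : H)
      ((earliest (fun u => l u) X v)%:R * (ln (y (l v)) - 1)
       + #|available (fun u => l u) X v|%:R * (y (l v))^-1)) / m%:R ^+ #|H|)).
    rewrite -mulr_suml ler_pM2r ?invr_gt0 ?exprn_gt0 //.
    by rewrite exchange_big /=; apply: ler_sum => l _; apply: step.
  rewrite mulr_natl -sumr_const; apply: ler_sum => X; rewrite inE => pmX.
  exact: average_choices_le.
by rewrite sumr_const card_ffun card_ord -[_ *+ (_ ^ _)%N]mulr_natr natrX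
  mulfK // expf_neq0 // gt_eqF.
Qed.
End Averaging.

(** * The limit *)
Lemma ler_of_le_div (R : realType) (a b c : R) :
  (forall m, (0 < m)%N -> a <= b + c / m%:R) -> a <= b.
Proof.
move=> h; apply/ler_addgt0Pr => e e0.
pose m := (Num.truncn (`|c| / e)).+1.
apply: le_trans (h m _) _ => //; rewrite lerD2l.
rewrite ler_pdivrMr ?ltr0n // (le_trans (ler_norm c)) // mulrC -ler_pdivrMr //.
exact/ltW/truncnS_gt.
Qed.

Lemma ln_card_matchings_le (R : realType) (H : hypergraph) (r k : nat)
    (theta : R) :
  uniform r.+2 H -> regular k H -> 0 <= theta ->
  (r.+2 * r.+1 * max_codegree H)%:R <= k%:R * theta ^+ r.+2 ->
  (0 < k)%N -> (0 < #|matchings H|)%N ->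
  ln #|matchings H|%:R
    <= #|H|%:R / r.+2%:R * (ln k%:R - r.+1%:R + r.+2%:R ^+ 2 * theta).
Proof.
move=> unifH regH th0 hcod k0 K0; set d : R := r.+2%:R.
have d0 : d != 0 by rewrite pnatr_eq0.
(* The constant collects the [1 / m] errors of the two Riemann sums: [ln k] from [mean_pow_le] and
   [d * r.+1] from [mean_pow_ln_le]. *)
apply: (@ler_of_le_div _ _ _ (#|H|%:R * (ln k%:R + d * r.+1%:R))) => m m0.
have mR : 0 < m%:R :> R by rewrite ltr0n.
apply: le_trans (ln_card_matchings_le_sum unifH regH th0 hcod m0 k0 K0) _.
pose q (i : 'I_m) : R := i.+1%:R / m%:R.
have q0 i : 0 < q i by rewrite divr_gt0 ?ltr0n.
have term (i : 'I_m) : m%:R^-1 * (q i ^+ r.+1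
      * ln (k%:R * (q i ^+ r.+1 + theta) ^+ r.+2))
    <= ln k%:R * (m%:R^-1 * q i ^+ r.+1)
       + d * r.+1%:R * (m%:R^-1 * (q i ^+ r.+1 * ln (q i)))
       + d * theta * m%:R^-1.
  have qr0 : 0 < q i ^+ r.+1 by rewrite exprn_gt0.
  have s0 : 0 < q i ^+ r.+1 + theta by rewrite ltr_pwDl.
  rewrite lnM ?posrE ?ltr0n ?exprn_gt0 // lnXn // -[ln _ *+ r.+2]mulr_natl -/d.
  (* The tangent at [q ^ r.+1] gives the error [theta / q ^ r.+1], whose denominator cancels against
     the outer factor. *)
  have := ln_le_tangent s0 qr0; rewrite lnXn // -[ln (q i) *+ _]mulr_natl.
  rewrite mulrDl divff ?gt_eqF // => tan.
  rewrite (_ : _ + _ + _ = m%:R^-1 * (q i ^+ r.+1 *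
     (ln k%:R + d * (r.+1%:R * ln (q i) + theta / q i ^+ r.+1)))); last first.
    by field; rewrite !gt_eqF.
  rewrite ler_pM2l ?invr_gt0 // ler_pM2l // lerD2l ler_pM2l ?ltr0n //.
  by apply: le_trans tan _; rewrite addrA addrAC addrK.
apply: le_trans (ler_wpM2l _ (ler_sum _ (fun i _ => term i))) _ => //.
rewrite -[X in _ <= X + _]mulrA -[X in _ <= _ + X]mulrA -[leRHS]mulrDr ler_wpM2l //.
rewrite !big_split /= -!mulr_sumr sumr_const card_ord -[_^-1 *+ m]mulr_natr
  mulVf ?gt_eqF //.
have lnk : 0 <= ln k%:R :> R by rewrite ln_ge0 // ler1n.
have h1 := ler_wpM2l lnk (mean_pow_le R r.+1 m0).
have h2 := @ler_wpM2l _ (d * r.+1%:R) (mulr_ge0 (ler0n _ _) (ler0n _ _)) _ _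
  (mean_pow_ln_le R r m0).
apply: le_trans (lerD (lerD h1 h2) (lexx _)) _; rewrite -/d.
rewrite le_eqVlt; apply/orP; left; apply/eqP.
by field; rewrite -natrD pnatr_eq0 gt_eqF.
Qed.

Lemma num_perfect_matchings_le (R : realType) (H : hypergraph) (d k : nat)
    (theta : R) :
  (2 <= d)%N -> uniform d H -> regular k H -> 0 <= theta ->
  (d * d.-1 * max_codegree H)%:R <= k%:R * theta ^+ d ->
  (num_perfect_matchings H)%:R
    <= (expR (d%:R ^+ 2 * theta) * (k%:R / expR 1 ^+ d.-1))
         `^ (#|H|%:R / d%:R).
Proof.
case: d => [|[|r]] // _ unifH regH th0 hcod.
have [-> |K0] := posnP (num_perfect_matchings H); first exact: powR_ge0.
have [H0|H0] := posnP #|H|.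
  (* Without vertices only the empty matching exists, and the right side is a zeroth power. *)
  rewrite H0 mul0r powRr0 -[1]/(1%:R) ler_nat.
  rewrite -(cards1 (finset.set0 : {set {set H}})) subset_leq_card //.
  apply/fintype.subsetP => M; rewrite !inE => pM.
  rewrite (matching_eq_blocks (ltn0Sn r.+1) unifH pM).
  by apply/eqP/setP => e; rewrite inE; apply/imsetP => -[v]; have := fintype0 v H0.
have /card_gt0P[M] := K0; rewrite inE => pM.
have /card_gt0P[v _] := H0.
have k0 : (0 < k)%N.
  rewrite -(regH v); apply/card_gt0P; exists (finset.pblock M v).
  by rewrite inE block_edge ?mem_block.
have KR : 0 < (num_perfect_matchings H)%:R :> R by rewrite ltr0n.
have b0 : 0 < expR (r.+2%:R ^+ 2 * theta) * (k%:R / expR 1 ^+ r.+1).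
  by rewrite mulr_gt0 ?expR_gt0 // divr_gt0 ?ltr0n ?exprn_gt0 ?expR_gt0.
rewrite -ler_ln ?posrE ?powR_gt0 // ln_powR.
apply: le_trans (ln_card_matchings_le unifH regH th0 hcod k0 K0) _.
rewrite lnM ?posrE ?expR_gt0 ?divr_gt0 ?ltr0n ?exprn_gt0 ?expR_gt0 // expRK.
rewrite ln_div ?posrE ?ltr0n ?exprn_gt0 ?expR_gt0 // lnXn ?expR_gt0 // expRK.
by rewrite addrC.
Qed.

Local Open Scope classical_set_scope.

Theorem theorem4 (R : realType) (d : nat) (hd : (2 <= d)%N)
    (H : nat -> hypergraph) (k : nat -> nat)
    (hn : forall n, #|H n| = n)
    (hunif : forall n, uniform d (H n))
    (hreg : forall n, regular (k n) (H n))
    (hk : k n @[n --> \oo] --> \oo)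
    (hcodeg : (fun n => (max_codegree (H n))%:R : R)
                =o_\oo (fun n => (k n)%:R : R)) :
  exists eps : nat -> R,
    eps n @[n --> \oo] --> 0 /\
    forall n : nat,
      (num_perfect_matchings (H n))%:R
        <= ((1 + eps n) * ((k n)%:R / expR 1 ^+ d.-1)) `^ (n%:R / d%:R).
Proof.
have d0 : (0 < d)%N by exact: ltnW.
have dR : d%:R != 0 :> R by rewrite pnatr_eq0 -lt0n.
pose rho n : R := (d * d.-1)%:R * ((max_codegree (H n))%:R / (k n)%:R).
(* This root makes [k * theta ^ d] equal to [d * d.-1 * max_codegree] when [k > 0]. *)
pose theta n : R := rho n `^ d%:R^-1.
have rho0 n : 0 <= rho n by rewrite mulr_ge0 // divr_ge0.
have rho_cvg : rho n @[n --> \oo] --> 0.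
  have C0 : 0 < (d * d.-1)%:R :> R by rewrite ltr0n muln_gt0 d0 -subn1 subn_gt0.
  apply/cvgr0Pnorm_le => e e0.
  have : \forall n \near \oo, `|(max_codegree (H n))%:R : R|
      <= e / (d * d.-1)%:R * `|(k n)%:R|.
    by move/eqoP: hcodeg; apply; rewrite divr_gt0.
  apply: filterS => n; rewrite !ger0_norm ?rho0 // => h.
  (* At [k n = 0], division by zero makes [rho n] vanish. *)
  have [k0|k0] := posnP (k n); first by rewrite /rho k0 invr0 mulr0 mulr0 ltW.
  rewrite /rho mulrA ler_pdivrMr ?ltr0n // mulrC -ler_pdivlMr //.
  by rewrite mulrAC.
have theta_cvg : theta n @[n --> \oo] --> 0.
  apply/cvgr0Pnorm_lt => e e0.
  move/cvgr0Pnorm_lt: rho_cvg => /(_ _ (exprn_gt0 d e0)); apply: filterS => n;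
    rewrite ger0_norm // => h.
  rewrite ger0_norm ?powR_ge0 // /theta.
  have -> : e = (e ^+ d) `^ d%:R^-1.
    by rewrite -powR_mulrn ?ltW // -powRrM mulfV // powRr1 ?ltW.
  apply: gt0_ltr_powR; rewrite ?nnegrE ?invr_gt0 ?ltr0n ?exprn_ge0 ?rho0 //.
  exact: ltW.
exists (fun n => expR (d%:R ^+ 2 * theta n) - 1); split.
  have : expR (d%:R ^+ 2 * theta n) @[n --> \oo] --> expR (d%:R ^+ 2 * 0 : R).
    apply: (@cvg_comp _ _ _ (fun n => d%:R ^+ 2 * theta n) (@expR R));
      last exact: (@continuous_expR R).
    exact: cvgMl_tmp.
  rewrite mulr0 expR0 => exp_cvg.
  by rewrite -[X in _ --> X](subrr 1); apply: cvgB => //; apply: cvg_cst.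
move=> n; rewrite addrC subrK.
have := @num_perfect_matchings_le R (H n) d (k n) (theta n) hd (hunif n) (hreg n).
rewrite hn; apply; first exact: powR_ge0.
rewrite /theta -powR_mulrn ?powR_ge0 // -powRrM mulVf // powRr1 //.
have [k0|k0] := posnP (k n); last first.
  by rewrite /rho mulrCA [_%:R * (_ / _)]mulrC divfK -?natrM // pnatr_eq0 -lt0n.
(* At [k n = 0] all codegrees vanish, being at most the degree. *)
suff -> : max_codegree (H n) = 0%N by rewrite muln0 mulr_ge0.
apply/eqP; rewrite -leqn0; apply/bigmax_leqP => -[u v] _ /=.
rewrite -k0 -(hreg n u); apply: subset_leq_card.
by apply/fintype.subsetP => e /[!inE] /and3P[-> ->].
Qed.
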